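(* Let $M^n$ be an $n$-dimensional submanifold of the Euclidean $m$-space $\mathbb{E}^m$ with position vector field $\mathbf{x}$, canonical vector field $\mathbf{x}^T$ and mean curvature vector field $H$. Then: (1) The canonical vector field $\mathbf{x}^T$ of $M^n$ is always conservative. (2) The canonical vector field $\mathbf{x}^T$ of $M^n$ is incompressible if and only if $\langle H,\mathbf{x}\rangle=-1$ holds identically on $M^n$.
   Context: $M^n$ is a connected Riemannian $n$-manifold isometrically immersed in $\mathbb{E}^m$; $\langle\cdot,\cdot\rangle$ is the Euclidean inner product. The position vector field $\mathbf{x}$ assigns to each point of $M^n$ its position vector in $\mathbb{E}^m$ relative to the origin, and $\mathbf{x}=\mathbf{x}^T+\mathbf{x}^N$ is its decomposition into components tangent and normal to $M^n$. The vector field $\mathbf{x}^T$ is called the canonical vector field of $M^n$. The mean curvature vector field is $H=\frac1n\,\mathrm{trace}\,h$, where $h$ is the second fundamental form, i.e. $\tilde\nabla_XY=\nabla_XY+h(X,Y)$ with $\nabla,\tilde\nabla$ the Levi-Civita connections of $M^n$ and $\mathbb{E}^m$. A vector field on a Riemannian manifold is conservative if it is the gradient of some function, and incompressible if its divergence vanishes at all points. *)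

(* Defs.v *)
From HB Require Import structures.
From mathcomp Require Import all_boot all_order all_algebra.
From mathcomp Require Import all_classical all_reals all_analysis.
From mathcomp Require Import lra.
Set Implicit Arguments.
Unset Strict Implicit.
Unset Printing Implicit Defensive.
Import Order.TTheory GRing.Theory Num.Theory.
Import numFieldNormedType.Exports.
Local Open Scope classical_set_scope.
Local Open Scope ring_scope.

Section Euclidean.
Context {R : realType}.

Definition dot {m} (u v : 'rV[R]_m) : R := \sum_i u 0 i * v 0 i.

Definition basis_vec {n} (i : 'I_n) : 'rV[R]_n := delta_mx 0 i.

(* Classes C^k and C^infinity on an open set U. *)
Fixpoint Ck (k : nat) (V W : normedModType R) (U : set V) (f : V -> W) : Prop :=
  if k is k'.+1 then
    (forall y, U y -> differentiable f y) /\ (forall v, Ck k' U ('D_v f))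
  else forall y, U y -> {for y, continuous f}.

Definition smooth_on (V W : normedModType R) (U : set V) (f : V -> W) : Prop :=
  forall k, Ck k U f.

End Euclidean.

(* cmap is a homeomorphism from the open set cdom onto an open subset of R^n;
   the values of cmap off cdom and of cinv off the image are irrelevant. *)
Record chart (R : realType) (n : nat) (T : topologicalType) := Chart {
  cdom : set T;
  cmap :> T -> 'rV[R]_n;
  cinv : 'rV[R]_n -> T;
  cdom_open : open cdom;
  cimg_open : open (cmap @` cdom);
  cmapK : forall p, cdom p -> cinv (cmap p) = p;
  cmap_continuous : forall p, cdom p -> {for p, continuous cmap};
  cinv_continuous : forall y, (cmap @` cdom) y -> {for y, continuous cinv}
}.

(* Smooth n-manifolds.  Every point has a preferred chart of the atlas. *)
Record manifold (R : realType) (n : nat) := Manifold {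
  points :> topologicalType;
  atlas : set (chart R n points);
  chart_at : points -> chart R n points;
  atlas_chart_at : forall p, atlas (chart_at p);
  chart_at_dom : forall p, cdom (chart_at p) p;
  atlas_compatible : forall c c', atlas c -> atlas c' ->
    smooth_on (c @` (cdom c `&` cdom c')) (c' \o cinv c);
  manifold_hausdorff : hausdorff_space points;
  manifold_second_countable : @second_countable points
}.

(* T_p M, identified with R^n by the basis of coordinate vectors at p of the
   preferred chart at p. *)
Definition tangent (R : realType) (n : nat) (M : manifold R n) (p : M) : Type :=
  'rV[R]_n.

Definition vector_field (R : realType) (n : nat) (M : manifold R n) : Type :=
  forall p : M, tangent p.

Section Manifold.
Context {R : realType} {n : nat} {M : manifold R n}.
Implicit Types (c : chart R n M) (p : M).

Definition smooth_map {W : normedModType R} (f : M -> W) : Prop :=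
  forall c, atlas c -> smooth_on (c @` cdom c) (f \o cinv c).

Definition dmap {W : normedModType R} (f : M -> W) p (v : tangent p) : W :=
  'd (f \o cinv (chart_at p)) (chart_at p p) v.

(* The tangent vector at q = cinv c y whose components in the chart c are v,
   and the components in the chart c of a vector field near y. *)
Definition of_coord c (y v : 'rV[R]_n) : tangent (cinv c y) :=
  'd (chart_at (cinv c y) \o cinv c) y v.

Definition field_in c (X : vector_field M) (y : 'rV[R]_n) : 'rV[R]_n :=
  dmap c (X (cinv c y)).

(* The matrix (g_ij) in the chart c. *)
Definition tensor_in c (g : forall p, tangent p -> tangent p -> R)
    (y : 'rV[R]_n) : 'M[R]_n :=
  \matrix_(i, j) g (cinv c y) (of_coord c y (basis_vec i))
                              (of_coord c y (basis_vec j)).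

End Manifold.

Record riemannian_metric (R : realType) (n : nat) (M : manifold R n) :=
  RiemannianMetric {
  metric :> forall p : M, tangent p -> tangent p -> R;
  metric_linear : forall (p : M) (a : R) (u v w : 'rV[R]_n),
    @metric p (a *: u + v) w = a * @metric p u w + @metric p v w;
  metric_sym : forall (p : M) (u v : tangent p), metric u v = metric v u;
  metric_pos : forall (p : M) (u : 'rV[R]_n), u != 0 -> 0 < @metric p u u;
  metric_smooth : forall c i j, atlas c ->
    smooth_on (c @` cdom c) (fun y => tensor_in c metric y i j)
}.

(* Local expressions in coordinates: G is the matrix of the metric, X and Y are
   the components of vector fields, F is a map to R^m read in the chart. *)
Section Coordinates.
Context {R : realType} {n m : nat}.
Implicit Types (G : 'rV[R]_n -> 'M[R]_n) (X Y : 'rV[R]_n -> 'rV[R]_n).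

(* Gamma^k_ij = 1/2 g^kl (d_i g_jl + d_j g_il - d_l g_ij) *)
Definition christoffel G (y : 'rV[R]_n) (k i j : 'I_n) : R :=
  2%:R^-1 * \sum_l invmx (G y) k l *
    ('D_(basis_vec i) (fun z => G z j l) y
     + 'D_(basis_vec j) (fun z => G z i l) y
     - 'D_(basis_vec l) (fun z => G z i j) y).

(* The two properties that characterize the Levi-Civita connection: it is
   torsion-free and compatible with the metric. *)
Lemma christoffel_sym G y k i j : (forall z, (G z)^T = G z) ->
  christoffel G y k i j = christoffel G y k j i.
Proof.
move=> Gsym; rewrite /christoffel; congr (_ * _).
apply: eq_bigr => l _; congr (_ * _).
have -> : (fun z => G z j i) = (fun z => G z i j).
  by apply/funext => z; rewrite -[in LHS]Gsym mxE.
by rewrite [X in X - _]addrC.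
Qed.

Lemma christoffel_metric G y i j k :
  (forall z, (G z)^T = G z) -> G y \in unitmx ->
  'D_(basis_vec k) (fun z => G z i j) y =
  \sum_l (christoffel G y l k i * G y l j + christoffel G y l k j * G y i l).
Proof.
move=> Gsym Gunit.
have GC a b z : G z a b = G z b a by rewrite -[in LHS]Gsym mxE.
pose T a b c := 2%:R^-1 *
  ('D_(basis_vec a) (fun z => G z b c) y + 'D_(basis_vec b) (fun z => G z a c) y
   - 'D_(basis_vec c) (fun z => G z a b) y).
have lower a b c : \sum_l christoffel G y l a b * G y l c = T a b c.
  rewrite /christoffel /T.
  under eq_bigr => l _.
    rewrite -mulrA mulr_suml.
    under eq_bigr => q _ do rewrite mulrAC.
    over.
  rewrite -mulr_sumr exchange_big /=; congr (_ * _).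
  under eq_bigr => q _.
    rewrite -mulr_suml.
    have -> : \sum_l invmx (G y) l q * G y l c = (c == q)%:R.
      under eq_bigr => l _ do rewrite GC mulrC.
      by have /matrixP/(_ c q) := mulmxV Gunit; rewrite !mxE.
    over.
  rewrite (bigD1 c) //= eqxx mul1r big1 ?addr0 // => q /negbTE qc.
  by rewrite eq_sym qc mul0r.
rewrite big_split /= lower.
under [X in _ + X]eq_bigr => l _ do rewrite GC.
rewrite lower /T.
have -> : (fun z => G z j i) = (fun z => G z i j).
  by apply/funext => z; rewrite GC.
by lra.
Qed.

(* Levi-Civita connection: the components of nabla_X Y. *)
Definition nabla G X Y (y : 'rV[R]_n) : 'rV[R]_n :=
  \row_k ('D_(X y) (fun z => Y z 0 k) y
          + \sum_i \sum_j christoffel G y k i j * X y 0 i * Y y 0 j).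

(* Gauss formula: h(X,Y) is the Euclidean derivative along X of the field F_* Y
   minus F_* (nabla_X Y). *)
Definition second_fundamental_form (F : 'rV[R]_n -> 'rV[R]_m) G X Y
    (y : 'rV[R]_n) : 'rV[R]_m :=
  'D_(X y) (fun z => 'd F z (Y z)) y - 'd F y (nabla G X Y y).

End Coordinates.

Section Riemannian.
Context {R : realType} {n : nat} {M : manifold R n}.
Implicit Types (g : riemannian_metric M) (X : vector_field M).

(* The trace of the endomorphism v |-> nabla_v X of T_p M; it may be computed
   in any chart. *)
Definition divergence g X (p : M) : R :=
  let c := chart_at p in
  \sum_i nabla (tensor_in c g) (cst (basis_vec i)) (field_in c X) (c p) 0 i.

Definition incompressible g X : Prop := forall p, divergence g X p = 0.

Definition is_gradient g (f : M -> R) X : Prop :=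
  forall p (v : tangent p), g p (X p) v = dmap f v.

Definition conservative g X : Prop :=
  exists f : M -> R, smooth_map f /\ is_gradient g f X.

End Riemannian.

Section Submanifold.
Context {R : realType} {n m : nat} {M : manifold R n}.
Implicit Types (g : riemannian_metric M) (x : M -> 'rV[R]_m).

Definition isometric_immersion g x : Prop :=
  smooth_map x /\
  forall p (u v : tangent p), dot (dmap x u) (dmap x v) = g p u v.

(* The trace of h with respect to g, divided by n; again the trace may be
   computed in any chart. *)
Definition mean_curvature g x (p : M) : 'rV[R]_m :=
  let c := chart_at p in
  let G := tensor_in c g in
  n%:R^-1 *: \sum_i \sum_j invmx (G (c p)) i j *:
    second_fundamental_form (x \o cinv c) G
      (cst (basis_vec i)) (cst (basis_vec j)) (c p).

Definition gram g (p : M) : 'M[R]_n :=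
  \matrix_(i, j) @metric _ _ _ g p (basis_vec i) (basis_vec j).

Definition tangential_part g x (p : M) (w : 'rV[R]_m) : tangent p :=
  (\row_j dot w (@dmap _ _ _ _ x p (basis_vec j))) *m invmx (gram g p).

(* The tangential part of w is the only u in T_p M for which w - dx(u) is
   normal to M. *)
Lemma tangential_partP g x (p : M) (w : 'rV[R]_m) (u : tangent p) :
  isometric_immersion g x ->
  (forall v : tangent p, dot (w - dmap x u) (dmap x v) = 0) <->
  u = tangential_part g x p w.
Proof.
move=> [_ iso].
have dotE (a b : 'rV[R]_m) : dot a b = (a *m b^T) 0 0.
  by rewrite /dot mxE; apply: eq_bigr => i _; rewrite mxE.
pose J := lin1_mx ('d (x \o cinv (chart_at p)) (chart_at p p)).
have dE (v : tangent p) : dmap x v = v *m J by rewrite mul_rV_lin1.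
have gE (a b : tangent p) : g p a b = (a *m (J *m J^T) *m b^T) 0 0.
  by rewrite -iso dotE !dE trmx_mul !mulmxA.
have gramE : gram g p = J *m J^T.
  apply/matrixP => i j; rewrite mxE gE /basis_vec -rowE trmx_delta.
  by rewrite -colE !mxE.
have Gunit : gram g p \in unitmx.
  rewrite -row_free_unit; apply: inj_row_free => v vG; apply/eqP.
  apply: contraPT isT => /(@metric_pos _ _ _ g p).
  by rewrite gE -gramE vG mul0mx mxE ltxx.
have rowE' : (\row_j dot w (@dmap _ _ _ _ x p (basis_vec j))) = w *m J^T.
  apply/rowP => j; rewrite mxE dotE dE -rowE tr_row.
  by rewrite colE mulmxA -colE mxE.
have resE v : dot (w - dmap x u) (@dmap _ _ _ _ x p v)
    = ((w *m J^T - u *m gram g p) *m v^T) 0 0.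
  by rewrite dotE !dE trmx_mul gramE !mulmxBl !mulmxA.
rewrite /tangential_part rowE'; split=> [nrm|-> v]; last first.
  by rewrite dotE !dE trmx_mul mulmxBl -!mulmxA [J *m (_ *m _)]mulmxA
     -gramE mulKmx // subrr mxE.
apply: (canRL (mulmxK Gunit)); apply/eqP; rewrite eq_sym -subr_eq0; apply/eqP.
apply/rowP => j; have := nrm (basis_vec j).
by rewrite resE /basis_vec trmx_delta -colE !mxE.
Qed.

Definition canonical_field g x : vector_field M :=
  fun p => tangential_part g x p (x p).

End Submanifold.

(* Main.v *)
(* The canonical field is the gradient of |x|^2 / 2, since the differential of
   this function at v is <x, dx v> = <dx x^T, dx v> = g(x^T, v).  For (2), read x
   in a chart as a map F and differentiate <x^T, d_j> = <F, d_j F> along d_i: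
   metric compatibility of the connection and the Gauss formula give
   <nabla_i x^T, d_j> = g_ij + <h(d_i, d_j), x>, and taking the trace with respect
   to g yields div x^T = n + n <H, x>. *)
Require Import Defs.
From mathcomp Require Import all_boot all_order all_algebra.
From mathcomp Require Import all_classical all_reals all_analysis.
Import Order.TTheory GRing.Theory Num.Theory.
Import numFieldNormedType.Exports.
Set Implicit Arguments.
Unset Strict Implicit.
Unset Printing Implicit Defensive.
Local Open Scope classical_set_scope.
Local Open Scope ring_scope.

(** * Locality of the differential; differentiability of determinants and inner products *)

Section Differentiability.
Context {R : realType} {V : normedModType R}.

(** Maps read in a chart are meaningful only on its open image, so each later identity between such
    maps is differentiated through this locality. *)
Lemma near_eq_differential {W : normedModType R} (f g : V -> W) (y : V) :
  (\forall z \near y, f z = g z) -> differentiable f y ->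
  differentiable g y /\ 'd g y = 'd f y :> (V -> W).
Proof.
move=> fg df.
have fgy : f y = g y := nbhs_singleton fg.
have cdf : continuous ('d f y) by exact: diff_continuous.
have E : g \o shift y = cst (g y) + 'd f y +o_ 0 id.
  apply/eqaddoP => _/posnumP[e].
  have /eqaddoP/(_ e%:num) := diff_locally df.
  move=> /(_ (gt0 e)) H.
  have fg0 : \forall h \near (0 : V), f (h + y) = g (h + y).
    by move: fg; rewrite (near_shift 0 y) /=; apply: filterS => h; rewrite subr0.
  near=> h.
  have Eh : f (h + y) = g (h + y) by near: h.
  by rewrite !fctE /= -Eh -fgy; near: h.
(* A continuous linear map giving a first-order expansion of [g] at [y] must be ['d g y]; with this
   value, [E] is the criterion for differentiability of [g]. *)
have D := diff_unique cdf E.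
by split => //; apply/diff_locallyP; rewrite D.
Unshelve. all: by end_near. Qed.

Lemma differentiable_fsum (I : finType) (f : I -> V -> R) y :
  (forall i, differentiable (f i) y) ->
  differentiable (fun z => \sum_i f i z) y.
Proof.
move=> df; rewrite -fct_sumE.
elim/big_ind : _ => //.
by move=> ? ? ? ?; exact: differentiableD.
Qed.

Lemma differentiable_fprod (I : finType) (f : I -> V -> R) y :
  (forall i, differentiable (f i) y) ->
  differentiable (fun z => \prod_i f i z) y.
Proof.
move=> df; rewrite -fct_prodE.
elim/big_ind : _ => //.
by move=> ? ? ? ?; exact: differentiableM.
Qed.

(** The Leibniz expansion is a polynomial in the entries. With the adjugate below, this prepares the
    use of Cramer's rule. *)
Lemma differentiable_det n (A : V -> 'M[R]_n) y :
  (forall i j, differentiable (fun z => A z i j) y) ->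
  differentiable (fun z => \det (A z)) y.
Proof.
move=> dA; apply: differentiable_fsum => s.
apply: differentiableM; first exact: differentiable_cst.
exact: differentiable_fprod.
Qed.

Lemma differentiable_adjugate n (A : V -> 'M[R]_n) y i j :
  (forall i j, differentiable (fun z => A z i j) y) ->
  differentiable (fun z => (\adj (A z)) i j) y.
Proof.
move=> dA; under eq_fun do rewrite mxE /cofactor.
apply: differentiableM; first exact: differentiable_cst.
by apply: differentiable_det => a b; under eq_fun do rewrite !mxE.
Qed.

Lemma differentiable_dot m (f g : V -> 'rV[R]_m) y :
  differentiable f y -> differentiable g y ->
  differentiable (fun z => dot (f z) (g z)) y.
Proof.
move=> df dg; apply: differentiable_fsum => i.
apply: differentiableM; apply: (differentiable_comp (g := fun N : 'rV[R]_m => N 0 i)) => //.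
  exact: differentiable_coord.
exact: differentiable_coord.
Qed.

Lemma is_derive_dot m (f g : V -> 'rV[R]_m) y v :
  differentiable f y -> differentiable g y ->
  is_derive y v (fun z => dot (f z) (g z))
    (dot ('D_v f y) (g y) + dot (f y) ('D_v g y)).
Proof.
move=> df dg.
have coordf (h : V -> 'rV[R]_m) i : differentiable h y ->
    is_derive y v (fun z => h z 0 i) ('D_v h y 0 i).
  move=> /diff_derivable-/(_ v) dh; apply: DeriveDef.
    exact: (derivable_mxP _ _ _).1.
  by rewrite derive_mx// mxE.
rewrite /dot -fct_sumE; apply: is_derive_eq.
  apply: is_derive_sum => i; apply: is_deriveM; exact: coordf.
rewrite -big_split /=; apply: eq_bigr => i _.
by rewrite addrC; congr (_ + _); exact: mulrC.
Qed.

End Differentiability.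

(** * Classes C^k on an open set and their closure properties *)

Section Smoothness.
Context {R : realType} {V : normedModType R}.
Variable U : set V.
Hypothesis oU : open U.

Lemma open_near_eq T (f g : V -> T) y :
  (forall z, U z -> f z = g z) -> U y -> \forall z \near y, f z = g z.
Proof. by move=> fg Uy; apply: filterS (open_nbhs_nbhs (conj oU Uy)). Qed.

(** As [U] is open, agreement on [U] is agreement near each of its points, so the directional
    derivatives agree on [U] too and the induction proceeds. *)
Lemma Ck_ext {W : normedModType R} k (f g : V -> W) :
  (forall z, U z -> f z = g z) -> Ck k U f -> Ck k U g.
Proof.
elim: k f g => [|k IH] f g fg /=.
  move=> cf y Uy; rewrite /prop_for /continuous_at -(fg _ Uy); apply: cvg_trans (cf y Uy).
  exact/near_eq_cvg/open_near_eq.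
move=> [df Df]; split=> [y Uy|v].
  by have [] := near_eq_differential (open_near_eq fg Uy) (df y Uy).
apply: IH (Df v) => z Uz; exact/near_eq_derive/open_near_eq.
Qed.

Lemma CkD {W : normedModType R} k (f g : V -> W) :
  Ck k U f -> Ck k U g -> Ck k U (f + g).
Proof.
elim: k f g => [|k IH] f g /=.
  by move=> cf cg y Uy; apply: continuousD; [exact: cf|exact: cg].
move=> [df Df] [dg Dg]; split=> [y Uy|v].
  by apply: differentiableD; [exact: df|exact: dg].
apply: Ck_ext (IH _ _ (Df v) (Dg v)) => z Uz.
by rewrite deriveD //; apply: diff_derivable; [exact: df|exact: dg].
Qed.

Lemma CkZ {W : normedModType R} k a (f : V -> W) :
  Ck k U f -> Ck k U (a *: f).
Proof.
elim: k f => [|k IH] f /=.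
  by move=> cf y Uy; apply: continuousZl_tmp; exact: cf.
move=> [df Df]; split=> [y Uy|v]; first by apply: differentiableZ; exact: df.
apply: Ck_ext (IH _ (Df v)) => z Uz.
by rewrite deriveZ //; apply: diff_derivable; exact: df.
Qed.

Lemma smooth_on_differentiable {W : normedModType R} (f : V -> W) y :
  smooth_on U f -> U y -> differentiable f y.
Proof. by move=> /(_ 1%N)[df _]; exact: df. Qed.

Lemma smooth_on_derive {W : normedModType R} (f : V -> W) v :
  smooth_on U f -> smooth_on U ('D_v f).
Proof. by move=> sf k; have [_] := sf k.+1; exact. Qed.

(** The derivative of the product is a sum of two products with one factor differentiated. The
    induction on [k] runs over all pairs of smooth factors, a class stable under differentiation. *)
Lemma smooth_on_dot m (f g : V -> 'rV[R]_m) :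
  smooth_on U f -> smooth_on U g -> smooth_on U (fun z => dot (f z) (g z)).
Proof.
move=> + + k; elim: k f g => [|k IH] f g sf sg /=.
  move=> y Uy; apply: differentiable_continuous.
  by apply: differentiable_dot; exact: smooth_on_differentiable Uy.
split=> [y Uy|v].
  by apply: differentiable_dot; exact: smooth_on_differentiable Uy.
have := CkD (IH _ _ (smooth_on_derive v sf) sg) (IH _ _ sf (smooth_on_derive v sg)).
apply: Ck_ext => z Uz.
have [_ ->//] := @is_derive_dot _ _ _ f g z v
  (smooth_on_differentiable sf Uz) (smooth_on_differentiable sg Uz).
Qed.

End Smoothness.

(** * Bilinearity of the Euclidean inner product *)

Section Dot.
Context {R : realType} {m : nat}.
Implicit Types u v w : 'rV[R]_m.

Lemma dotC u v : dot u v = dot v u.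
Proof. by apply: eq_bigr => i _; rewrite mulrC. Qed.

Lemma dotBl u v w : dot (u - v) w = dot u w - dot v w.
Proof. by rewrite /dot -sumrB; apply: eq_bigr => i _; rewrite !mxE mulrBl. Qed.

Lemma dotZl a u v : dot (a *: u) v = a * dot u v.
Proof. by rewrite /dot mulr_sumr; apply: eq_bigr => i _; rewrite mxE mulrA. Qed.

Lemma dot_suml (I : finType) (f : I -> 'rV[R]_m) v :
  dot (\sum_i f i) v = \sum_i dot (f i) v.
Proof.
rewrite /dot exchange_big; apply: eq_bigr => i _ /=.
by rewrite summxE mulr_suml.
Qed.

End Dot.

Lemma dot_differential_sum (R : realType) n m (F : 'rV[R]_n -> 'rV[R]_m) y u w :
  dot ('d F y u) w = \sum_k u 0 k * dot ('d F y (basis_vec k)) w.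
Proof.
rewrite [X in 'd F y X](row_sum_delta u) linear_sum dot_suml.
by apply: eq_bigr => k _; rewrite linearZ dotZl.
Qed.

(** * The divergence of the tangential part of the position vector, in coordinates *)

Section Coordinates.
Context {R : realType} {n m : nat}.
Variables (U : set 'rV[R]_n) (F : 'rV[R]_n -> 'rV[R]_m).
Variables (G : 'rV[R]_n -> 'M[R]_n) (V : 'rV[R]_n -> 'rV[R]_n).
Hypothesis oU : open U.
Hypothesis sF : smooth_on U F.
Hypothesis Gsym : forall z, (G z)^T = G z.
Hypothesis Gunit : forall z, U z -> G z \in unitmx.
Hypothesis GE : forall z i j, U z ->
  G z i j = dot ('d F z (basis_vec i)) ('d F z (basis_vec j)).
(** With [GE], this says that [F - dF(V)] is orthogonal to every [d_j F]: [V] is the tangential part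
    of the position vector [F], in components. *)
Hypothesis VE : forall z j, U z ->
  \sum_a V z 0 a * G z a j = dot (F z) ('d F z (basis_vec j)).

Lemma derivative_smooth_map z v : U z -> 'D_v F z = 'd F z v.
Proof. by move=> Uz; rewrite deriveE //; exact: smooth_on_differentiable Uz. Qed.

(** On [U] the frame vector is the directional derivative ['D_(basis_vec i) F], which is again
    smooth. *)
Lemma differentiable_frame z i : U z ->
  differentiable (fun y => 'd F y (basis_vec i)) z.
Proof.
move=> Uz; have dDF := smooth_on_differentiable (smooth_on_derive (basis_vec i) sF) Uz.
apply: (near_eq_differential _ dDF).1; apply: (open_near_eq oU _ Uz) => y Uy.
exact: derivative_smooth_map.
Qed.

Lemma differentiable_first_fundamental_form z i j : U z ->
  differentiable (fun y => G y i j) z.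
Proof.
move=> Uz; apply: (near_eq_differential _
  (differentiable_dot (differentiable_frame i Uz) (differentiable_frame j Uz))).1.
by apply: (open_near_eq oU _ Uz) => y Uy; rewrite GE.
Qed.

(* Cramer's rule expresses V rationally in G and the differentiable functions
   <F, d_j F>, whence its differentiability. *)
Lemma differentiable_tangential_coord z i : U z ->
  differentiable (fun y => V y 0 i) z.
Proof.
move=> Uz.
pose W y := \sum_j dot (F y) ('d F y (basis_vec j)) *
  ((\det (G y))^-1 * (\adj (G y)) j i).
have WV y : U y -> W y = V y 0 i.
  move=> Uy; have := mulmxK (Gunit Uy) (V y).
  rewrite /invmx Gunit // => /rowP/(_ i) <-; rewrite !mxE; apply: eq_bigr => j _.
  by rewrite !mxE VE.
apply: (near_eq_differential (open_near_eq oU WV Uz) _).1.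
have dG := differentiable_first_fundamental_form.
apply: differentiable_fsum => j; apply: differentiableM.
  apply: differentiable_dot; first exact: smooth_on_differentiable Uz.
  exact: differentiable_frame.
apply: differentiableM; last by apply: differentiable_adjugate => a b; exact: dG.
apply: differentiableV; first by apply: differentiable_det => a b; exact: dG.
by rewrite -unitfE -unitmxE; exact: Gunit.
Qed.

Lemma nabla_tangential z i j : U z ->
  \sum_l nabla G (cst (basis_vec i)) V z 0 l * G z l j =
  G z i j + dot (second_fundamental_form F G (cst (basis_vec i))
                   (cst (basis_vec j)) z) (F z).
Proof.
move=> Uz.
pose D f := 'D_(basis_vec i) f z : R.
have dV a : derivable (fun y => V y 0 a) z (basis_vec i).
  exact/diff_derivable/differentiable_tangential_coord.
have dG a b : derivable (fun y => G y a b) z (basis_vec i).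
  exact/diff_derivable/differentiable_first_fundamental_form.
(* Both sides of [VE] are differentiated along [d_i]. On the right, the term [<d_i F, d_j F>] is
   [G z i j]. *)
have product_rule : \sum_a (D (fun y => V y 0 a) * G z a j
      + V z 0 a * D (fun y => G y a j))
    = G z i j + dot (F z) ('D_(basis_vec i) (fun y => 'd F y (basis_vec j)) z).
  have -> : G z i j + dot (F z) ('D_(basis_vec i) (fun y => 'd F y (basis_vec j)) z)
      = D (fun y => dot (F y) ('d F y (basis_vec j))).
    have [_ dE] := @is_derive_dot _ _ _ F (fun y => 'd F y (basis_vec j)) z
      (basis_vec i) (smooth_on_differentiable sF Uz) (differentiable_frame j Uz).
    by rewrite GE // /D [RHS]dE derivative_smooth_map.
  have -> : D (fun y => dot (F y) ('d F y (basis_vec j)))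
      = D (fun y => \sum_a V y 0 a * G y a j).
    by apply: near_eq_derive; apply: (open_near_eq oU _ Uz) => y Uy; rewrite VE.
  rewrite /D -fct_sumE.
  rewrite (derive_sum (h := fun a y => V y 0 a * G y a j)); last first.
    by move=> a; exact: derivableM.
  apply: eq_bigr => a _; rewrite deriveM // addrC; congr (_ + _).
  by rewrite [LHS]mulrC.
have nablaE l : nabla G (cst (basis_vec i)) V z 0 l =
    D (fun y => V y 0 l) + \sum_a christoffel G z l i a * V z 0 a.
  rewrite mxE /=; congr (_ + _); rewrite (bigD1 i) //= [X in _ + X]big1 ?addr0.
    by apply: eq_bigr => a _; rewrite !mxE !eqxx mulr1.
  move=> k ki; apply: big1 => a _.
  by rewrite !mxE (negbTE ki) andbF mulr0 mul0r.
have nabla_frame l : nabla G (cst (basis_vec i)) (cst (basis_vec j)) z 0 l =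
    christoffel G z l i j.
  rewrite mxE /= derive_cst add0r (bigD1 i) //= [X in _ + X]big1 ?addr0.
    rewrite (bigD1 j) //= big1 ?addr0 => [|a aj].
      by rewrite !mxE !eqxx !mulr1.
    by rewrite !mxE (negbTE aj) andbF mulr0.
  move=> k ki; apply: big1 => a _.
  by rewrite !mxE (negbTE ki) andbF mulr0 mul0r.
rewrite /second_fundamental_form dotBl [dot ('D__ _ _) _]dotC addrA.
rewrite -product_rule dot_differential_sum.
under eq_bigr do rewrite nablaE mulrDl.
rewrite !big_split /= -addrA; congr (_ + _).
(* The tangential correction in the Gauss formula, paired with [F], becomes the sum of
   [Gamma^l_ij V^a g_al] by [VE]. *)
under [X in _ - X]eq_bigr do rewrite nabla_frame dotC -VE //.
apply/esym/eqP; rewrite subr_eq; apply/eqP.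
(* Metric compatibility reads [d_i g_aj = Gamma^l_ia g_lj + Gamma^l_ij g_al]: the first term matches
   the Christoffel part of [nabla_i V], the second the Gauss correction. *)
under eq_bigr do rewrite /D (christoffel_metric _ _ _ Gsym (Gunit Uz)) mulr_sumr.
rewrite exchange_big /= -big_split /=; apply: eq_bigr => l _.
rewrite mulr_suml mulr_sumr -big_split /=; apply: eq_bigr => a _.
by rewrite mulrDr; congr (_ + _); rewrite mulrCA // mulrA.
Qed.

(** In matrix form [nabla_tangential] is [N G = G + S], so [N = 1 + S G^-1], and the trace of the
    identity contributes [n]. *)
Lemma divergence_tangential z : U z ->
  \sum_i nabla G (cst (basis_vec i)) V z 0 i = n%:R +
  \sum_i \sum_j invmx (G z) i j *
    dot (second_fundamental_form F G (cst (basis_vec i))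
           (cst (basis_vec j)) z) (F z).
Proof.
move=> Uz.
pose N := \matrix_(i, l) nabla G (cst (basis_vec i)) V z 0 l.
pose S := \matrix_(i, j) dot (second_fundamental_form F G (cst (basis_vec i))
           (cst (basis_vec j)) z) (F z).
have NG : N *m G z = G z + S.
  apply/matrixP => i j; rewrite !mxE -nabla_tangential //.
  by apply: eq_bigr => l _; rewrite mxE.
have NE : N = 1%:M + S *m invmx (G z).
  by rewrite -(mulmxV (Gunit Uz)) -mulmxDl -NG mulmxK // Gunit.
have -> : \sum_i nabla G (cst (basis_vec i)) V z 0 i = \tr N.
  by apply: eq_bigr => i _; rewrite [RHS]mxE.
rewrite NE mxtraceD mxtrace1; congr (_ + _).
apply: eq_bigr => i _; rewrite mxE; apply: eq_bigr => j _.
(* The trace of [S G^-1] pairs [S i j] with the entry [j i] of the inverse; symmetry of [G]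
   exchanges the indices. *)
by rewrite mxE mulrC -{1}[G z]Gsym -trmx_inv mxE.
Qed.

End Coordinates.

(** * Change of charts for differentials and tangent vectors *)

Section Charts.
Context {R : realType} {n : nat} {M : manifold R n}.
Implicit Types (c : chart R n M) (p : M).

Lemma cinv_dom c y : (c @` cdom c) y -> cdom c (cinv c y) /\ c (cinv c y) = y.
Proof. by move=> [q cq <-]; rewrite cmapK. Qed.

(** Inside the image of [c], the overlap is the preimage of the open set [cdom c'] under [cinv c],
    which is continuous there. *)
Lemma chart_overlap_open c c' : open (c @` (cdom c `&` cdom c')).
Proof.
have -> : c @` (cdom c `&` cdom c') =
    (c @` cdom c) `&` [set y | cdom c' (cinv c y)].
  apply/seteqP; split=> [y [q [cq c'q] <-]|y [cy c'y]].
    by split; [exists q | rewrite /= cmapK].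
  by have [? cE] := cinv_dom cy; exists (cinv c y).
rewrite openE => y [cy c'y].
apply: filterI.
  by apply: open_nbhs_nbhs; split=> //; exact: cimg_open.
by apply: (cinv_continuous cy); apply: open_nbhs_nbhs; split=> //; exact: cdom_open.
Qed.

Lemma transition_differentiable c c' q : atlas c -> atlas c' ->
  cdom c q -> cdom c' q -> differentiable (c' \o cinv c) (c q).
Proof.
move=> Ac Ac' cq c'q.
by apply: smooth_on_differentiable (atlas_compatible Ac Ac') _; exists q.
Qed.

(** Chain rule: [f \o cinv c] factors through the transition map on the overlap, an open
    neighbourhood of [c q]. *)
Lemma differential_change_chart {W : normedModType R} (f : M -> W) c c' q v :
  smooth_map f -> atlas c -> atlas c' -> cdom c q -> cdom c' q ->
  'd (f \o cinv c) (c q) v =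
  'd (f \o cinv c') (c' q) ('d (c' \o cinv c) (c q) v).
Proof.
move=> sf Ac Ac' cq c'q.
have dt := transition_differentiable Ac Ac' cq c'q.
have df : differentiable (f \o cinv c') ((c' \o cinv c) (c q)).
  by rewrite /= cmapK //; apply: smooth_on_differentiable (sf c' Ac') _; exists q.
have E : \forall z \near c q,
    ((f \o cinv c') \o (c' \o cinv c)) z = (f \o cinv c) z.
  apply: (open_near_eq (@chart_overlap_open c c')) => [z [r [cr c'r] <-]|].
    by rewrite /= (cmapK cr) (cmapK c'r).
  by exists q.
have [_ dE] := near_eq_differential E (differentiable_comp dt df).
apply: (etrans (congr1 (@^~ v) dE)).
apply: (etrans (congr1 (@^~ v) (diff_comp dt df))).
by rewrite /= (cmapK cq).
Qed.

(** The transition maps to the preferred chart and back compose to the identity near [c q], hence so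
    do their differentials. *)
Lemma of_coordK c q v : atlas c -> cdom c q ->
  dmap c (of_coord c (c q) v) = v.
Proof.
move=> Ac cq.
rewrite /dmap /of_coord (cmapK cq).
set c' := chart_at q.
have Ac' : atlas c' := atlas_chart_at q.
have c'q : cdom c' q := chart_at_dom q.
have d1 := transition_differentiable Ac Ac' cq c'q.
have d2 : differentiable (c \o cinv c') ((c' \o cinv c) (c q)).
  by rewrite /= cmapK //; exact: transition_differentiable.
have E : \forall z \near c q, ((c \o cinv c') \o (c' \o cinv c)) z = id z.
  apply: (open_near_eq (@chart_overlap_open c c')) => [z [r [cr c'r] <-]|].
    by rewrite /= (cmapK cr) (cmapK c'r).
  by exists q.
have [_ dE] := near_eq_differential E (differentiable_comp d1 d2).
have : 'd ((c \o cinv c') \o (c' \o cinv c)) (c q) v = v.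
  apply: (etrans (esym (congr1 (@^~ v) dE))).
  exact: (congr1 (@^~ v) (@diff_val _ _ _ _ _ _ _ (is_diff_id (c q)))).
apply: etrans; apply: (etrans _ (esym (congr1 (@^~ v) (diff_comp d1 d2)))).
by rewrite /= (cmapK cq).
Qed.

End Charts.

(** * The canonical field of an isometric immersion, read in charts *)

Section Submanifold.
Context {R : realType} {n m : nat} {M : manifold R n}.
Variables (g : riemannian_metric M) (x : M -> 'rV[R]_m).
Hypothesis iso : isometric_immersion g x.
Implicit Types (c : chart R n M) (p : M).

Lemma dmap_of_coord c q v : atlas c -> cdom c q ->
  dmap x (of_coord c (c q) v) = 'd (x \o cinv c) (c q) v.
Proof.
move=> Ac cq; have [sx _] := iso.
rewrite (differential_change_chart v sx Ac (atlas_chart_at q) cq (chart_at_dom q)).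
by rewrite /dmap /of_coord (cmapK cq).
Qed.

Lemma dmap_field_in c q (X : vector_field M) : atlas c -> cdom c q ->
  'd (x \o cinv c) (c q) (field_in c X (c q)) = dmap x (X q).
Proof.
move=> Ac cq; have [sx _] := iso.
rewrite /field_in (cmapK cq).
exact: (esym (differential_change_chart (X q) sx (atlas_chart_at q) Ac
  (chart_at_dom q) cq)).
Qed.

Lemma tensor_in_sym c y : (tensor_in c g y)^T = tensor_in c g y.
Proof. by apply/matrixP => i j; rewrite !mxE Defs.metric_sym. Qed.

Lemma tensor_inE c y i j : atlas c -> (c @` cdom c) y ->
  tensor_in c g y i j = dot ('d (x \o cinv c) y (basis_vec i))
                            ('d (x \o cinv c) y (basis_vec j)).
Proof.
move=> Ac [q cq <-]; rewrite mxE; have [_ <-] := iso.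
by rewrite !dmap_of_coord.
Qed.

(** If [v] is in the kernel, the tangent vector with components [v] has length zero. It is nonzero
    when [v] is, by [of_coordK], against positivity of the metric. *)
Lemma tensor_in_unit c y : atlas c -> (c @` cdom c) y ->
  tensor_in c g y \in unitmx.
Proof.
move=> Ac cy; rewrite -row_free_unit; apply: inj_row_free => v vG.
have [q cq qy] := cy.
apply/eqP; apply: contraPT isT => v0.
have w0 : (of_coord c (c q) v : 'rV_n) != 0.
  apply: contra v0 => /eqP w0; rewrite -(of_coordK v Ac cq) w0.
  by rewrite /dmap linear0.
have := @metric_pos _ _ _ g (cinv c (c q)) _ w0.
rewrite -iso.2 dmap_of_coord // qy.
rewrite dot_differential_sum big1 ?ltxx // => i _.
rewrite dotC dot_differential_sum.
suff -> : \sum_k v 0 k * dot ('d (x \o cinv c) y (basis_vec k))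
    ('d (x \o cinv c) y (basis_vec i)) = 0 by rewrite mulr0.
move/rowP : vG => /(_ i); rewrite mxE [RHS]mxE; apply: etrans.
by apply: eq_bigr => k _; rewrite tensor_inE.
Qed.

Lemma canonical_fieldP p (v : tangent p) :
  dot (dmap x (canonical_field g x p)) (dmap x v) = dot (x p) (dmap x v).
Proof.
have /(_ v)/eqP := (tangential_partP (x p) (canonical_field g x p) iso).2 erefl.
by rewrite dotBl subr_eq0 => /eqP.
Qed.

(** This supplies the hypothesis [VE] of the coordinate computation. *)
Lemma canonical_field_inE c y j : atlas c -> (c @` cdom c) y ->
  \sum_a field_in c (canonical_field g x) y 0 a * tensor_in c g y a j =
  dot ((x \o cinv c) y) ('d (x \o cinv c) y (basis_vec j)).
Proof.
move=> Ac cy; under eq_bigr do rewrite tensor_inE //.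
have [q cq <-] := cy; rewrite -dot_differential_sum dmap_field_in //.
by rewrite -dmap_of_coord // /= (cmapK cq) canonical_fieldP.
Qed.

Lemma canonical_field_conservative : conservative g (canonical_field g x).
Proof.
have [sx isom] := iso.
exists (2^-1 *: (fun p => dot (x p) (x p))); split=> [c Ac|p v].
  move=> k; apply: CkZ; first exact: cimg_open.
  by apply: smooth_on_dot; [exact: cimg_open|exact: sx|exact: sx].
have cp := chart_at_dom p.
have dx : differentiable (x \o cinv (chart_at p)) (chart_at p p).
  by apply: smooth_on_differentiable (sx _ (atlas_chart_at p)) _; exists p.
rewrite -isom canonical_fieldP /dmap.
have dxx := differentiable_dot dx dx.
rewrite (diffZ 2^-1 dxx) /= -(deriveE _ dxx).
have [_ ->] := is_derive_dot v dx dx.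
(* The two terms of the product rule coincide by symmetry, and the factor 1/2 cancels the resulting
   2. *)
rewrite (deriveE _ dx) /= (cmapK cp) [dot ('d _ _ _) _]dotC -mulr2n.
by rewrite -[dot _ _ *+ 2]mulr_natl -[RHS]/(2^-1 * _) mulKf // pnatr_eq0.
Qed.

Lemma divergence_canonical_field p : (0 < n)%N -> divergence g (canonical_field g x) p =
  n%:R + n%:R * dot (mean_curvature g x p) (x p).
Proof.
move=> n_gt0; have [sx _] := iso; pose c := chart_at p.
have Ac : atlas c := atlas_chart_at p.
have cp : cdom c p := chart_at_dom p.
(* The coordinate formula is taken in the preferred chart at [p], with [x \o cinv c] as [F], the
   metric tensor as [G] and the components of the canonical field as [V]. *)
rewrite /divergence (@divergence_tangential _ _ _ (c @` cdom c) (x \o cinv c)) //.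
- congr (_ + _); rewrite /mean_curvature dotZl.
  rewrite mulVKf ?pnatr_eq0 -?lt0n // dot_suml; apply: eq_bigr => i _.
  rewrite dot_suml; apply: eq_bigr => j _.
  by rewrite dotZl /= (cmapK cp).
- exact: cimg_open.
- exact: sx.
- exact: tensor_in_sym.
- by move=> z; exact: tensor_in_unit.
- by move=> z i j; exact: tensor_inE.
- by move=> z j; exact: canonical_field_inE.
- by exists p.
Qed.

End Submanifold.

Theorem theorem3p1 (R : realType) (n m : nat) (M : manifold R n)
    (g : riemannian_metric M) (x : M -> 'rV[R]_m) :
  (0 < n)%N ->
  connected [set: M] ->
  isometric_immersion g x ->
  conservative g (canonical_field g x) /\
  (incompressible g (canonical_field g x) <->
   forall p : M, dot (mean_curvature g x p) (x p) = -1).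
Proof.
move=> n_gt0 _ iso; split; first exact: canonical_field_conservative.
have n0 : n%:R != 0 :> R by rewrite pnatr_eq0 -lt0n.
(* The divergence is [n (1 + <H, x>)] with [n] nonzero, so the equivalence holds point by point. *)
have E p : (divergence g (canonical_field g x) p = 0) <->
    dot (mean_curvature g x p) (x p) = -1.
  rewrite divergence_canonical_field // -{1}[n%:R]mulr1 -mulrDr; split=> [/eqP|->].
    by rewrite mulf_eq0 (negbTE n0) /= addrC addr_eq0 => /eqP.
  by rewrite subrr mulr0.
by split=> H p; apply/E.
Qed.
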